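(* For all positive integers $m$ and $t$, \[ \sum_{k=1}^{t}(-1)^{k-1}\frac{b^k q^{\frac{k(k+1)}{2}+(m-1)k}}{(1-q^k)^m}\begin{bmatrix} t\\ k\end{bmatrix}_{q,b} =\sum_{j_1=1}^{t}\frac{b^{j_1}q^{j_1}}{1-q^{j_1}}\sum_{j_2=1}^{j_1}\frac{q^{j_2}}{1-q^{j_2}}\cdots\sum_{j_m=1}^{j_{m-1}}\frac{q^{j_m}}{1-q^{j_m}}, \] where \[ \begin{bmatrix} t\\ k\end{bmatrix}_{q,b}:=\sum_{\substack{\lambda\text{ partition},\ \lambda_1\le t-k,\ \ell(\lambda)\le k}} b^{\lambda_1}q^{|\lambda|}. \]
   Context: A partition $\lambda=(\lambda_1,\dots,\lambda_\ell)$ is a finite weakly decreasing sequence of positive integers (including the empty partition, with $\lambda_1:=0$, $\ell=0$, $|\lambda|=0$); $\ell(\lambda)=\ell$ is its length and $|\lambda|=\sum_i\lambda_i$. $b$ and $q$ are indeterminates; identities are of formal power series in $q$. When $b=1$, $\begin{bmatrix} t\\ k\end{bmatrix}_{q,1}$ is the ordinary $q$-binomial coefficient. *)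

(* Defs.v *)
From HB Require Import structures.
From mathcomp Require Import all_boot all_order all_algebra.
From mathcomp Require Import mathcomp_extra boolp classical_sets functions.
From mathcomp Require Import cardinality fsbigop.

Set Implicit Arguments.
Unset Strict Implicit.
Unset Printing Implicit Defensive.

Import GRing.Theory.

Local Open Scope ring_scope.

(* The ring A[[q]]. A record rather than the bare type nat -> A, which already
   carries the pointwise product. *)
Record fps (A : Type) := FPS { fps_coef : nat -> A }.

Lemma fpsP (A : Type) (f g : fps A) : fps_coef f =1 fps_coef g -> f = g.
Proof. by case: f => f; case: g => g /= /funext ->. Qed.

HB.instance Definition _ (A : Type) := gen_eqMixin (fps A).
HB.instance Definition _ (A : Type) := gen_choiceMixin (fps A).

Section FpsZmodule.
Variable A : zmodType.
Implicit Types f g : fps A.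

Definition fps_zero : fps A := FPS (fun=> 0).
Definition fps_opp f : fps A := FPS (fun n => - fps_coef f n).
Definition fps_add f g : fps A := FPS (fun n => fps_coef f n + fps_coef g n).

Lemma fps_addA : associative fps_add.
Proof. by move=> f g h; apply: fpsP => n /=; rewrite addrA. Qed.

Lemma fps_addC : commutative fps_add.
Proof. by move=> f g; apply: fpsP => n /=; rewrite addrC. Qed.

Lemma fps_add0 : left_id fps_zero fps_add.
Proof. by move=> f; apply: fpsP => n /=; rewrite add0r. Qed.

Lemma fps_addN : left_inverse fps_zero fps_opp fps_add.
Proof. by move=> f; apply: fpsP => n /=; rewrite addNr. Qed.

HB.instance Definition _ :=
  GRing.isZmodule.Build (fps A) fps_addA fps_addC fps_add0 fps_addN.

End FpsZmodule.

Section FpsRing.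
Variable A : comNzRingType.
Implicit Types f g h : fps A.

Definition fpsC (c : A) : fps A := FPS (fun n => if n == 0%N then c else 0).
Definition fpsX : fps A := FPS (fun n => (n == 1%N)%:R).
Definition fps_mul f g : fps A :=
  FPS (fun n => \sum_(i < n.+1) fps_coef f i * fps_coef g (n - i)).

Definition fps_trunc (n : nat) f : {poly A} := \poly_(i < n) fps_coef f i.

Lemma coef_fps_mul f g (N n : nat) : (n < N)%N ->
  fps_coef (fps_mul f g) n = (fps_trunc N f * fps_trunc N g)`_n.
Proof.
move=> nN; rewrite coefM; apply: eq_bigr => i _; rewrite !coef_poly.
rewrite (leq_ltn_trans (leq_subr _ _) nN).
by rewrite (leq_ltn_trans _ nN) // -ltnS.
Qed.

Lemma fps_mulA : associative fps_mul.
Proof.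
move=> f g h; apply: fpsP => n.
transitivity ((fps_trunc n.+1 f * (fps_trunc n.+1 g * fps_trunc n.+1 h))`_n).
  rewrite (@coef_fps_mul _ _ n.+1) // !coefM; apply: eq_bigr => i _.
  by rewrite [X in _ * X]coef_poly ltnS leq_subr (@coef_fps_mul _ _ n.+1) //
             ltnS leq_subr.
rewrite mulrA (@coef_fps_mul _ _ n.+1) // !coefM; apply: eq_bigr => i _.
by rewrite [in RHS]coef_poly ltn_ord (@coef_fps_mul _ _ n.+1).
Qed.

Lemma fps_mulC : commutative fps_mul.
Proof.
by move=> f g; apply: fpsP => n; rewrite !(@coef_fps_mul _ _ n.+1) // mulrC.
Qed.

Lemma fps_mul1 : left_id (fpsC 1) fps_mul.
Proof.
move=> f; apply: fpsP => n /=; rewrite big_ord_recl /= mul1r subn0.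
by rewrite big1 ?addr0 // => i _; rewrite mul0r.
Qed.

Lemma fps_mulDl : left_distributive fps_mul +%R.
Proof.
move=> f g h; apply: fpsP => n /=; rewrite -big_split /=.
by apply: eq_bigr => i _; rewrite mulrDl.
Qed.

Lemma fps_oner_neq0 : fpsC 1 != 0.
Proof.
apply/eqP => /(congr1 (fun f => fps_coef f 0)) /= /eqP.
by rewrite (negbTE (oner_neq0 A)).
Qed.

HB.instance Definition _ := GRing.Zmodule_isComNzRing.Build (fps A)
  fps_mulA fps_mulC fps_mul1 fps_mulDl fps_oner_neq0.

End FpsRing.

Section FpsUnitRing.
Variable A : comUnitRingType.
Implicit Types f g : fps A.

(* A power series is invertible iff its constant coefficient is; the inverse
   is computed from g_0 = f_0^-1, g_(n+1) = - f_0^-1 sum_(i <= n) f_(i+1) g_(n-i).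
   As usual in MathComp, the inverse is the identity outside the units. *)
Definition fps_unit : {pred fps A} :=
  fun f => fps_coef f 0 \is a GRing.unit.

Fixpoint fps_inv_seq f (n : nat) : seq A :=
  if n is n'.+1 then
    let s := fps_inv_seq f n' in
    rcons s (- (fps_coef f 0)^-1
               * \sum_(i < n'.+1) fps_coef f i.+1 * s`_(n' - i))
  else [:: (fps_coef f 0)^-1].

Definition fps_inv f : fps A :=
  if fps_unit f then FPS (fun n => (fps_inv_seq f n)`_n) else f.

Lemma size_fps_inv_seq f n : size (fps_inv_seq f n) = n.+1.
Proof. by elim: n => //= n IHn; rewrite size_rcons IHn. Qed.

Lemma nth_fps_inv_seq f n i : (i <= n)%N ->
  (fps_inv_seq f n)`_i = (fps_inv_seq f i)`_i.
Proof.
elim: n => [|n IHn]; first by case: i.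
rewrite leq_eqVlt => /predU1P[-> //|]; rewrite ltnS => i_le_n.
by rewrite /= nth_rcons size_fps_inv_seq ltnS i_le_n IHn.
Qed.

Lemma fps_mulVx : {in fps_unit, left_inverse 1 fps_inv *%R}.
Proof.
move=> f uf; rewrite mulrC; apply: fpsP => -[|n] /=.
  by rewrite big_ord1 /fps_inv [fps_unit f]uf /= mulrV.
rewrite big_ord_recl /= /fps_inv [fps_unit f]uf /=.
rewrite subn0 nth_rcons size_fps_inv_seq ltnn eqxx mulrA mulrN mulrV //.
rewrite mulN1r addrC; apply/eqP; rewrite subr_eq0; apply/eqP.
apply: eq_bigr => i _; rewrite /= /bump /= add1n subSS.
by rewrite [in RHS]nth_fps_inv_seq // leq_subr.
Qed.

Lemma fps_unitPl f g : g * f = 1 -> fps_unit f.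
Proof.
move=> /(congr1 (fun h => fps_coef h 0)) /=; rewrite big_ord1 subn0 => gf1.
by apply/unitrP; exists (fps_coef g 0); split=> //; rewrite mulrC.
Qed.

Lemma fps_inv_out : {in [predC fps_unit], fps_inv =1 id}.
Proof. by move=> f /negbTE uf; rewrite /fps_inv [fps_unit f]uf. Qed.

HB.instance Definition _ := GRing.ComNzRing_hasMulInverse.Build (fps A)
  fps_mulVx fps_unitPl fps_inv_out.

Lemma fps_unitE f : (f \is a GRing.unit) = (fps_coef f 0 \is a GRing.unit).
Proof. by []. Qed.

End FpsUnitRing.

Lemma coef_fpsXn (A : comNzRingType) (k n : nat) :
  fps_coef (fpsX A ^+ k) n = (n == k)%:R.
Proof.
elim: k n => [|k IHk] n; first by rewrite expr0 /=; case: n.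
rewrite exprS [LHS]/= big_ord_recl /= mul0r add0r.
case: n => [|n]; first by rewrite big_ord0.
rewrite big_ord_recl /= mul1r /bump /= subSS subn0 IHk eqSS.
by rewrite big1 ?addr0 // => i _; rewrite mul0r.
Qed.

Lemma fps_unit_1subXn (A : comUnitRingType) (k : nat) :
  (0 < k)%N -> 1 - fpsX A ^+ k \is a GRing.unit.
Proof.
case: k => // k _.
by rewrite fps_unitE [fps_coef _ _]/= coef_fpsXn subr0 unitr1.
Qed.

Definition is_partition (l : seq nat) : bool :=
  sorted geq l && all (fun i => 0 < i)%N l.

Definition largest_part (l : seq nat) : nat := head 0%N l.

(* The condition lambda_1 <= t - k is written without truncated subtraction:
   there is no such partition when t < k. *)
Definition box_partitions (t k : nat) : set (seq nat) :=
  [set l | [/\ is_partition l, (largest_part l + k <= t)%N & (size l <= k)%N]]%classic.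

Lemma finite_box_partitions (t k : nat) : finite_set (box_partitions t k).
Proof.
pose F (u : k.-bseq 'I_t.+1) : seq nat := map val (val u).
apply: (@sub_finite_set _ _ (F @` setT)%classic); last first.
  exact/finite_image/finite_finset.
move=> l [/andP[sl _] ht sk].
have le_t i : i \in l -> (i < t.+1)%N.
  case: l sl ht {sk} => //= x l /(order_path_min (rev_trans leq_trans)).
  move=> /allP lx xt; rewrite ltnS inE => /predU1P[->|/lx /= ix].
    exact: leq_trans (leq_addr _ _) xt.
  exact: leq_trans ix (leq_trans (leq_addr _ _) xt).
have sz : (size [seq inord i : 'I_t.+1 | i <- l] <= k)%N by rewrite size_map.
exists (Bseq sz) => //; rewrite /F /= -map_comp -[RHS]map_id.
by apply/eq_in_map => i /le_t; exact: inordK.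
Qed.

Definition qb_binomial (A : comNzRingType) (q b : A) (t k : nat) : A :=
  \sum_(l \in box_partitions t k) b ^+ largest_part l * q ^+ sumn l.

(* nested_sum q r j = sum_(1 <= j_1 <= j) q^j_1/(1-q^j_1) * ...
                        * sum_(1 <= j_r <= j_(r-1)) q^j_r/(1-q^j_r). *)
Fixpoint nested_sum (A : comUnitRingType) (q : A) (r j : nat) : A :=
  if r is r'.+1 then
    \sum_(1 <= i < j.+1) q ^+ i / (1 - q ^+ i) * nested_sum q r' i
  else 1.

(* Main.v *)
(** Adding a row of maximal length [t - k] to a partition gives the Pascal rule
    [[t+1, k+1]_b = [t, k+1]_b + (b q)^(t-k) [t, k]_1]. Hence both sides of the
    identity have increments in [t] that are [(b q)^(t+1)] times a series free
    of [b], and comparing them is Dilcher's identity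
    [\sum_(k >= 1) (-1)^(k-1) q^(binom(k,2) + r k) / (1 - q^k)^r [t, k]_1 = N_r(t)]
    where [r = m - 1] and [N_r(t)] is the nested sum. The latter follows by
    induction on [r] and [t] from the Pascal rule at [b = 1] and the absorption
    rule [(1 - q^(k+1)) [t+1, k+1]_1 = (1 - q^(t+1)) [t, k]_1]. *)

Require Import Defs.
From mathcomp Require Import all_boot all_order all_algebra.
From mathcomp Require Import classical_sets functions cardinality fsbigop.
From mathcomp Require Import zify ring.

Set Implicit Arguments.
Unset Strict Implicit.
Unset Printing Implicit Defensive.

Import GRing.Theory.

Local Open Scope ring_scope.

Lemma box_partitions_nil (t k : nat) :
  (k == 0%N) || (k == t) -> (k <= t)%N -> box_partitions t k = [set [::]]%classic.
Proof.
move=> kt le_kt; apply/seteqP; split=> [l [lpart hl sl]|l ->] /=; last first.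
  by split.
case: l lpart hl sl => [//|x l] /andP[_ /= /andP[x0 _]] hl sl.
by case/orP: kt => /eqP kE; lia.
Qed.

Lemma box_partitions_gt (t k : nat) : (t < k)%N -> box_partitions t k = set0.
Proof. by move=> tk; apply/seteqP; split=> [l [_ hl _]|//]; lia. Qed.

Lemma is_partition_cons (x : nat) (l : seq nat) :
  is_partition (x :: l) = [&& 0 < x, largest_part l <= x & is_partition l]%N.
Proof.
rewrite /is_partition; case: l => [|y l] /=; first by rewrite !andbT.
by rewrite /geq /=; case: (y <= x)%N; case: (0 < x)%N; rewrite ?andbF.
Qed.

(** The largest part is either below [t - k] or equal to it; in the second case, removing it leaves
    at most [k] parts. The bound [k < t] makes the prepended part positive. *)
Lemma box_partitionsS (t k : nat) : (k < t)%N ->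
  box_partitions t.+1 k.+1 =
    (box_partitions t k.+1 `|` cons (t - k)%N @` box_partitions t k)%classic.
Proof.
move=> kt; apply/seteqP; split=> l.
  move=> [lpart hl sl]; have [hl'|hl'] := leqP (largest_part l + k.+1) t.
    by left.
  right; case: l lpart hl sl hl' => [|x l] /=; first by lia.
  rewrite is_partition_cons => /and3P[x0 lx lpart] hl sl hl'.
  by exists l; [split=> //; lia|congr cons; lia].
case=> [[lpart hl sl]|[l' [lpart hl sl] <-]]; first by split=> //; lia.
by split; rewrite ?is_partition_cons ?lpart ?andbT /=; lia.
Qed.

Section QBinomial.
Variables (A : comNzRingType) (q : A).

Local Notation gauss := (qb_binomial q 1).

Lemma qb_binomial_nil (b : A) (t k : nat) :
  (k == 0%N) || (k == t) -> (k <= t)%N -> qb_binomial q b t k = 1.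
Proof.
by move=> *; rewrite /qb_binomial box_partitions_nil// fsbig_set1 /= mulr1.
Qed.

Lemma qb_binomial_gt (b : A) (t k : nat) : (t < k)%N -> qb_binomial q b t k = 0.
Proof. by move=> tk; rewrite /qb_binomial box_partitions_gt// fsbig_set0. Qed.

(** The prepended part becomes the largest one and carries the whole power of [b], so the remaining
    partition is counted at [b = 1]. *)
Lemma qb_binomial_pascal (b : A) (t k : nat) :
  qb_binomial q b t.+1 k.+1 =
    qb_binomial q b t k.+1 + (b * q) ^+ (t - k) * gauss t k.
Proof.
have [kt|tk|->] := ltngtP k t; last 2 first.
- by rewrite !qb_binomial_gt ?mulr0 ?addr0// ltnS ltnW.
- rewrite subnn qb_binomial_nil ?eqxx ?orbT// qb_binomial_gt//.
  by rewrite qb_binomial_nil ?eqxx ?orbT// add0r mul1r.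
rewrite {1}/qb_binomial box_partitionsS// fsbigU //=; last 3 first.
- exact: finite_box_partitions.
- exact/finite_image/finite_box_partitions.
- by move=> l [[_ hl _] [l' _ E]]; move: hl; rewrite -E /=; lia.
congr (_ + _).
rewrite (reindex_fsbig (cons (t - k)%N) (box_partitions t k)); last first.
  by apply: inj_bij => l l' _ _ [].
have fin := finite_box_partitions t k.
rewrite /qb_binomial !fsbig_finite//= mulr_sumr; apply: eq_bigr => l _.
by rewrite expr1n mul1r exprMn exprD mulrA.
Qed.

Lemma gauss_ratio (n k : nat) :
  (1 - q ^+ k.+1) * gauss n k.+1 = (1 - q ^+ (n - k)) * gauss n k.
Proof.
elim: n k => [|n IHn] k.
  by rewrite sub0n expr0 subrr mul0r qb_binomial_gt// mulr0.
rewrite qb_binomial_pascal mul1r mulrDr IHn.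
case: k => [|k].
  rewrite !subn0 [gauss n 0]qb_binomial_nil// [gauss n.+1 0]qb_binomial_nil//.
  by rewrite expr1 (exprS q n); ring.
rewrite subSS qb_binomial_pascal mul1r.
have [nk|kn] := leqP n k.
  have -> : (n - k = 0)%N by lia.
  by rewrite [gauss n k.+1]qb_binomial_gt// subrr !(mulr0, mul0r, addr0).
(* The hypothesis at [k] turns the term in [gauss n k] on the right into a multiple of
   [gauss n k.+1], the only binomial left on either side. *)
move: (IHn k).
have -> : (n - k = (n - k.+1).+1)%N by lia.
rewrite !(exprS q); set x := q ^+ (n - k.+1); set y := q ^+ k => E.
by rewrite [RHS]mulrDr [X in _ = _ + X]mulrCA -E; ring.
Qed.

Lemma gauss_absorb (n k : nat) : (k <= n)%N ->
  (1 - q ^+ k.+1) * gauss n.+1 k.+1 = (1 - q ^+ n.+1) * gauss n k.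
Proof.
move=> kn; rewrite qb_binomial_pascal mul1r mulrDr gauss_ratio.
have -> : q ^+ n.+1 = q ^+ (n - k) * q ^+ k.+1.
  by rewrite -exprD; congr (_ ^+ _); lia.
by ring.
Qed.

(** The dual Pascal rule: its difference with the first one is exactly [gauss_ratio]. *)
Lemma gauss_pascal' (n k : nat) :
  gauss n.+1 k.+1 = q ^+ k.+1 * gauss n k.+1 + gauss n k.
Proof.
apply/eqP; rewrite -subr_eq0 qb_binomial_pascal mul1r.
move: (gauss_ratio n k) => /eqP; rewrite -subr_eq0 => /eqP <-.
by apply/eqP; ring.
Qed.

(** This is the case [r = 0] of Dilcher's identity. By the dual Pascal rule the partial sums
    telescope, and the boundary term at [N = n.+1] contains [gauss n n.+1 = 0]. *)
Lemma alternating_gauss_sum (n : nat) :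
  \sum_(k < n.+1) (-1) ^+ k * q ^+ 'C(k.+1, 2) * gauss n.+1 k.+1 = 1.
Proof.
have tele N : \sum_(k < N) (-1) ^+ k * q ^+ 'C(k.+1, 2) * gauss n.+1 k.+1 =
    1 - (-1) ^+ N * q ^+ 'C(N.+1, 2) * gauss n N.
  elim: N => [|N IHN].
    by rewrite big_ord0 qb_binomial_nil// !mul1r subrr.
  rewrite big_ord_recr /= IHN gauss_pascal' (binS N.+1 1) bin1 addnC.
  by rewrite exprD (exprS (-1)); ring.
by rewrite tele (@qb_binomial_gt _ n n.+1)// mulr0 subr0.
Qed.

Lemma sum_qb_binomial_pascal (b : A) (c : nat -> A) (t : nat) :
  \sum_(k < t.+1) c k * qb_binomial q b t.+1 k.+1 =
    \sum_(k < t) c k * qb_binomial q b t k.+1 +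
    \sum_(k < t.+1) c k * ((b * q) ^+ (t - k) * gauss t k).
Proof.
under eq_bigr do rewrite qb_binomial_pascal mulrDr.
rewrite big_split /=; congr (_ + _).
by rewrite big_ord_recr /= qb_binomial_gt// mulr0 addr0.
Qed.

End QBinomial.

Section Dilcher.
Variables (A : comUnitRingType) (q : A).
Hypothesis unit_1subXn : forall k, (0 < k)%N -> 1 - q ^+ k \is a GRing.unit.

Local Notation gauss := (qb_binomial q 1).

Lemma gauss_absorb_div (n k : nat) : (k <= n)%N ->
  gauss n k = (1 - q ^+ k.+1) * gauss n.+1 k.+1 / (1 - q ^+ n.+1).
Proof. by move=> kn; rewrite gauss_absorb// mulrAC mulrV ?mul1r// unit_1subXn. Qed.

(** The index is shifted: this is the coefficient of the binomial with lower entry [k.+1], whence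
    the sign [(-1) ^+ k]. *)
Definition dilcher_coef (r k : nat) : A :=
  (-1) ^+ k * q ^+ ('C(k.+1, 2) + r * k.+1) / (1 - q ^+ k.+1) ^+ r.

Lemma dilcher_coefS (r k : nat) :
  dilcher_coef r.+1 k * (1 - q ^+ k.+1) = q ^+ k.+1 * dilcher_coef r k.
Proof.
have u := unit_1subXn (ltn0Sn k).
rewrite /dilcher_coef mulSn addnCA exprD.
set d := 1 - _ in u *; rewrite (exprS d) invrM ?unitrX// -!mulrA mulVr//.
by rewrite mulr1; ring.
Qed.

Lemma dilcher_coefE (b : A) (r k : nat) :
  (-1) ^+ k * (b ^+ k.+1 * q ^+ (k.+1 + 'C(k.+1, 2) + r * k.+1) /
    (1 - q ^+ k.+1) ^+ r.+1) =
  b ^+ k.+1 * q ^+ k.+1 * dilcher_coef r k / (1 - q ^+ k.+1).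
Proof.
have u := unit_1subXn (ltn0Sn k).
rewrite /dilcher_coef -addnA exprD.
by set d := 1 - _ in u *; rewrite (exprS d) invrM ?unitrX//; ring.
Qed.

Lemma dilcher (r t : nat) :
  \sum_(k < t.+1) dilcher_coef r k * gauss t.+1 k.+1 = nested_sum q r t.+1.
Proof.
elim: r t => [|r IHr] t.
  rewrite -[RHS](alternating_gauss_sum q t); apply: eq_bigr => k _.
  by rewrite /dilcher_coef mul0n addn0 expr0 invr1 mulr1.
(* For positive rank the identity also holds at [s = 0], where the induction starts. At rank 0 it
   fails there: the empty sum is 0 but [nested_sum q 0 0] is 1. *)
suff E s : \sum_(k < s) dilcher_coef r.+1 k * gauss s k.+1 = nested_sum q r.+1 s.
  exact: E.
elim: s => [|s IHs]; first by rewrite big_ord0 /= big_geq.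
rewrite sum_qb_binomial_pascal IHs /= [RHS]big_nat_recr //=; congr (_ + _).
rewrite -IHr mulr_sumr; apply: eq_bigr => k _.
have ks : (k <= s)%N by rewrite -ltnS.
(* Absorption supplies the factor [1 - q ^+ k.+1] that lowers the rank to [r]. The [q ^+ k.+1] this
   releases completes [q ^+ (s - k)] to [q ^+ s.+1], which is free of [k]. *)
rewrite (gauss_absorb_div ks) mul1r.
have -> : q ^+ s.+1 = q ^+ (s - k) * q ^+ k.+1.
  by rewrite -exprD; congr (_ ^+ _); lia.
transitivity (q ^+ (s - k) * (dilcher_coef r.+1 k * (1 - q ^+ k.+1)) *
  gauss s.+1 k.+1 / (1 - q ^+ (s - k) * q ^+ k.+1)); first by ring.
by rewrite dilcher_coefS; ring.
Qed.

Lemma qb_binomial_nested_sum (b : A) (r t : nat) :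
  \sum_(k < t) b ^+ k.+1 * q ^+ k.+1 * dilcher_coef r k / (1 - q ^+ k.+1) *
     qb_binomial q b t k.+1 =
  \sum_(1 <= j < t.+1) b ^+ j * q ^+ j / (1 - q ^+ j) * nested_sum q r j.
Proof.
elim: t => [|t IHt]; first by rewrite big_ord0 big_geq.
rewrite (sum_qb_binomial_pascal q b (fun k => b ^+ k.+1 * q ^+ k.+1 *
  dilcher_coef r k / (1 - q ^+ k.+1))) IHt [RHS]big_nat_recr //=; congr (_ + _).
rewrite -dilcher mulr_sumr; apply: eq_bigr => k _.
have kt : (k <= t)%N by rewrite -ltnS.
rewrite (gauss_absorb_div kt).
have u := unit_1subXn (ltn0Sn k).
rewrite -[in RHS]exprMn.
(* The weight [b ^+ k.+1 * q ^+ k.+1] makes the power of [b * q] independent of [k]; the factor from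
   absorption then cancels the denominator [1 - q ^+ k.+1]. *)
have -> : (b * q) ^+ t.+1 = (b * q) ^+ (t - k) * (b ^+ k.+1 * q ^+ k.+1).
  by rewrite -exprMn -exprD; congr (_ ^+ _); lia.
transitivity (b ^+ k.+1 * q ^+ k.+1 * dilcher_coef r k * (b * q) ^+ (t - k) *
  gauss t.+1 k.+1 / (1 - q ^+ t.+1) * ((1 - q ^+ k.+1) / (1 - q ^+ k.+1))).
  by ring.
by rewrite mulrV// mulr1; ring.
Qed.

End Dilcher.

Theorem theorem4p5 (R : idomainType) (m t : nat) (hm : (0 < m)%N) (ht : (0 < t)%N) :
  let q : fps {poly R} := fpsX {poly R} in
  let b : fps {poly R} := fpsC 'X in
  \sum_(1 <= k < t.+1)
     (-1) ^+ (k - 1) *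
     (b ^+ k * q ^+ ((k * (k + 1)) %/ 2 + (m - 1) * k) / (1 - q ^+ k) ^+ m) *
     qb_binomial q b t k
  = \sum_(1 <= j < t.+1)
     b ^+ j * q ^+ j / (1 - q ^+ j) * nested_sum q (m - 1) j.
Proof.
move=> q b; have unitq k : (0 < k)%N -> 1 - q ^+ k \is a GRing.unit.
  exact: fps_unit_1subXn.
rewrite -(qb_binomial_nested_sum unitq) big_add1 /= big_mkord.
apply: eq_bigr => k _; congr (_ * _).
case: m hm => // r _; rewrite subn1 /= subn1 /=.
(* The triangular number is split to free the [q ^+ k.+1] that pairs with [b ^+ k.+1]. *)
have -> : ((k.+1 * (k.+1 + 1)) %/ 2 = k.+1 + 'C(k.+1, 2))%N.
  by rewrite addn1 mulnC divn2 -(bin2 k.+2) binS bin1 addnC.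
exact: dilcher_coefE.
Qed.
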